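(* For every graph $H$ and every $c \in [0,1]$, $$\mathcal{M}_H(c) = \limsup_{G \in \mathcal{C}_c} t(H,G) = \limsup_{G \in \mathcal{C}_c \cap \mathcal{T}} t(H,G),$$ where $\mathcal{T}$ denotes the set of all threshold graphs.
   Context: Graphs are finite and simple; $|G|$ is the number of vertices of $G$. A homomorphism from $H$ to $G$ is a map $V(H)\to V(G)$ sending edges to edges; $\hom(H,G)$ is the number of homomorphisms, and $t(H,G) = \hom(H,G)/|G|^{|H|}$. For $c\in[0,1]$, $\mathcal{C}_c = \{G : t(K_2,G)\le c\}$. For a class $\mathcal{C}$ of graphs, $\limsup_{G\in\mathcal{C}} f(G) = \lim_{n\to\infty}\sup\{f(G): G\in\mathcal{C}, |G|\ge n\}$. By definition $\mathcal{M}_H(c)=\limsup_{G\in\mathcal{C}_c} t(H,G)$. $N(u)$ is the neighborhood of $u$ and $\overline{N(u)} = N(u)\cup\{u\}$ its closed neighborhood. A graph is a threshold graph if for any two vertices $u,v$ we have $N(u)\subseteq \overline{N(v)}$ or $N(v)\subseteq\overline{N(u)}$. *)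

(* Defs.v *)
From HB Require Import structures.
From mathcomp Require Import all_boot all_order all_algebra.
From mathcomp Require Import all_classical all_reals all_analysis.
Set Implicit Arguments.
Unset Strict Implicit.
Unset Printing Implicit Defensive.
Import Order.TTheory GRing.Theory Num.Theory.
Import numFieldNormedType.Exports.
Local Open Scope classical_set_scope.
Local Open Scope ring_scope.

Record graph := Graph {
  vertex :> finType;
  edge : rel vertex;
  edge_sym : symmetric edge;
  edge_irr : irreflexive edge }.

Definition K2_edge : rel 'I_2 := fun x y => x != y.

Lemma K2_edge_sym : symmetric K2_edge.
Proof. by move=> x y; rewrite /K2_edge eq_sym. Qed.

Lemma K2_edge_irr : irreflexive K2_edge.
Proof. by move=> x; rewrite /K2_edge eqxx. Qed.

Definition K2 : graph := Graph K2_edge_sym K2_edge_irr.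

Definition is_hom (H G : graph) (phi : {ffun H -> G}) : bool :=
  [forall x, forall y, edge x y ==> edge (phi x) (phi y)].

Definition num_hom (H G : graph) : nat :=
  #|[set phi : {ffun H -> G} | is_hom phi]%SET|.

(* If G has no vertices and H has at least one, the quotient is 0 / 0 = 0;
   this value does not affect limits along #|G| -> oo. *)
Definition hom_density (R : realType) (H G : graph) : R :=
  (num_hom H G)%:R / #|G|%:R ^+ #|H|.

Definition nbhd (G : graph) (u : G) : {set G} := [set v | edge u v]%SET.

Definition closed_nbhd (G : graph) (u : G) : {set G} := (u |: nbhd u)%SET.

Definition is_threshold (G : graph) : Prop :=
  forall u v : G,
    nbhd u \subset closed_nbhd v \/ nbhd v \subset closed_nbhd u.

(* Classes of graphs are bare predicates: [set graph] is rejected for universe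
   reasons, [Finite.type] being above the universe of [set]. *)
Definition density_class (R : realType) (c : R) (G : graph) : Prop :=
  hom_density R K2 G <= c.

Definition sup_from (R : realType) (C : graph -> Prop) (f : graph -> R)
    (n : nat) : \bar R :=
  ereal_sup [set y | exists G : graph, [/\ C G, (n <= #|G|)%N & y = (f G)%:E]].

(* The suprema are taken in \bar R, where the sup of the empty set is -oo. *)
Definition graph_limsup (R : realType) (C : graph -> Prop) (f : graph -> R) :
    \bar R :=
  limn (sup_from C f).

Lemma is_cvg_sup_from (R : realType) (C : graph -> Prop) (f : graph -> R) :
  cvgn (sup_from C f).
Proof.
apply: ereal_nonincreasing_is_cvgn => m n lemn.
apply: ereal_sup_le => _ [G [CG nG ->]].
by exists G; split => //; exact: leq_trans nG.
Qed.

Definition max_density (R : realType) (H : graph) (c : R) : \bar R :=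
  graph_limsup (density_class c) (hom_density R H).

(* Main.v *)
(* Add all loops to G and compress: for u later than v in a fixed order of the
   vertices, replace each edge ub with vb missing (b different from u and v) by
   vb.  This keeps the number of edges.  Because of the loops it does not
   decrease the number of homomorphisms from H: fixing the preimage of {u, v}
   and the values outside it, each vertex (or component) of the preimage has
   either both choices available, which remain available, or at most one, which
   can be replaced by v.  Each compression lowers the sum of the ranks of the
   endpoints of the edges, so the process stops, at a graph with nested
   neighborhoods.  Removing the loops gives a threshold graph on the same
   vertices with the same edge density as G; it only destroys homomorphisms
   identifying the ends of an edge of H, which changes t(H, -) by at most
   |H|^2 / |G|. *)
Require Import Defs.
From mathcomp Require Import all_boot all_order all_algebra.
From mathcomp Require Import perm.
From mathcomp Require Import all_classical all_reals all_analysis.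
Import Order.TTheory GRing.Theory Num.Theory.
Import numFieldNormedType.Exports.
Set Implicit Arguments.
Unset Strict Implicit.
Unset Printing Implicit Defensive.

(** * Compression of a relation *)

Definition rel_homs (S T : finType) (e : rel S) (E : rel T) :
    {set {ffun S -> T}} :=
  [set phi : {ffun S -> T} |
    [forall x, forall y, e x y ==> E (phi x) (phi y)]]%SET.

Lemma rel_homsP (S T : finType) (e : rel S) (E : rel T) (phi : {ffun S -> T}) :
  reflect (forall x y, e x y -> E (phi x) (phi y)) (phi \in rel_homs e E).
Proof.
rewrite inE; apply: (iffP forallP) => [h x y exy|h x].
  by have /forallP/(_ y)/implyP := h x; apply.
by apply/forallP => y; apply/implyP; exact: h.
Qed.

Definition moved (T : finType) (E : rel T) (u v b : T) : bool :=
  [&& b != u, b != v, E u b & ~~ E v b].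

(* The involution of pairs that exchanges (u, b) with (v, b), and (b, u) with
   (b, v), for the moved vertices b. *)
Definition shift (T : finType) (E : rel T) (u v : T) (p : T * T) : T * T :=
  if moved E u v p.2 then (tperm u v p.1, p.2)
  else if moved E u v p.1 then (p.1, tperm u v p.2) else p.

(** A pullback of [E] along an involution, so that counts and sums over its pairs reindex to those
    of [E]. *)
Definition compress (T : finType) (E : rel T) (u v : T) : rel T :=
  fun a b => E (shift E u v (a, b)).1 (shift E u v (a, b)).2.

Lemma moved_tperm (T : finType) (E : rel T) (u v b : T) :
  moved E u v (tperm u v b) = moved E u v b.
Proof. by case: tpermP => // ->; rewrite /moved !eqxx ?andbF. Qed.

Lemma tperm_moved (T : finType) (E : rel T) (u v b : T) :
  moved E u v b -> tperm u v b = b.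
Proof. by case/and4P=> bu bv _ _; rewrite tpermD // eq_sym. Qed.

Lemma shiftK (T : finType) (E : rel T) (u v : T) : involutive (shift E u v).
Proof.
move=> [a b]; rewrite /shift /=.
case mb: (moved E u v b) => /=; first by rewrite mb tpermK.
case ma: (moved E u v a) => /=; last by rewrite mb ma.
by rewrite moved_tperm mb ma tpermK.
Qed.

Lemma compress_refl (T : finType) (E : rel T) (u v : T) :
  reflexive E -> reflexive (compress E u v).
Proof.
move=> Er a; rewrite /compress /shift /=.
by case ma: (moved E u v a); rewrite /= ?(tperm_moved ma) Er.
Qed.

Lemma compress_sym (T : finType) (E : rel T) (u v : T) :
  symmetric E -> symmetric (compress E u v).
Proof.
move=> Es a b; rewrite /compress /shift /=.
case mb: (moved E u v b); case ma: (moved E u v a); rewrite /= 1?Es //.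
by rewrite (tperm_moved ma) (tperm_moved mb).
Qed.

Lemma compress_out (T : finType) (E : rel T) (u v a b : T) :
  a != u -> a != v -> b != u -> b != v -> compress E u v a b = E a b.
Proof.
move=> au av bu bv; rewrite /compress /shift /=.
have ta : tperm u v a = a by rewrite tpermD // eq_sym.
have tb : tperm u v b = b by rewrite tpermD // eq_sym.
by case: ifP => _ /=; rewrite ?ta //; case: ifP => _ /=; rewrite ?tb.
Qed.

Lemma compress_in (T : finType) (E : rel T) (u v a b : T) :
  a \in pred2 u v -> b \in pred2 u v -> compress E u v a b = E a b.
Proof.
have nm c : c \in pred2 u v -> moved E u v c = false.
  by case/orP => /eqP ->; rewrite /moved eqxx ?andbF.
by move=> ha hb; rewrite /compress /shift /= !nm.
Qed.

Lemma compress_l (T : finType) (E : rel T) (u v b : T) :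
  b != u -> b != v -> compress E u v u b = E u b && E v b.
Proof.
move=> bu bv; rewrite /compress /shift /= /moved bu bv eqxx /=.
by case: (boolP (E u b)); case: (boolP (E v b)) => hv hu /=;
  rewrite ?tpermL ?(negbTE hv) ?hv ?hu ?(negbTE hu).
Qed.

Lemma compress_r (T : finType) (E : rel T) (u v b : T) :
  b != u -> b != v -> compress E u v v b = E u b || E v b.
Proof.
move=> bu bv; rewrite /compress /shift /= /moved bu bv eqxx /= andbF.
by case: (boolP (E u b)); case: (boolP (E v b)) => hv hu /=;
  rewrite ?tpermR ?(negbTE hv) ?hv ?hu ?(negbTE hu).
Qed.

Lemma card_compress (T : finType) (E : rel T) (u v : T) :
  #|[set p | compress E u v p.1 p.2]%SET| = #|[set p | E p.1 p.2]%SET|.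
Proof.
rewrite -(card_imset _ (inv_inj (shiftK E u v))).
apply: eq_card => -[a b]; rewrite inE.
rewrite -[(a, b) in LHS](shiftK E u v) mem_imset ?inE; last first.
  exact: inv_inj (shiftK E u v).
by rewrite /compress -surjective_pairing shiftK.
Qed.

Definition rank_sum (T : finType) (E : rel T) : nat :=
  \sum_(p : T * T | E p.1 p.2) (enum_rank p.1 + enum_rank p.2).

(** Reindexing along [shift] compares the two sums pair by pair: no pair of [E] gains rank, and
    [(u, b)] loses some. *)
Lemma rank_sum_compress (T : finType) (E : rel T) (u v b : T) :
  symmetric E -> (enum_rank v < enum_rank u)%N -> moved E u v b ->
  (rank_sum (compress E u v) < rank_sum E)%N.
Proof.
move=> Es ltvu mb; rewrite /rank_sum.
rewrite (reindex_inj (inv_inj (shiftK E u v))) /=.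
rewrite (eq_bigl (fun p => E p.1 p.2)); last first.
  by move=> p; rewrite /compress -surjective_pairing shiftK.
(* A moved [c] is not adjacent to [v], so [a] is not [v] and the transposition can only lower its
   rank. *)
have lt_perm a c : E a c -> moved E u v c ->
    (enum_rank (tperm u v a) <= enum_rank a)%N.
  by move=> Eac /and4P[_ _ _ nvc]; case: tpermP => [->|eav|//];
    [exact: ltnW | rewrite -eav Eac in nvc].
have Eub : E u b by case/and4P: mb.
rewrite (bigD1 (u, b)) //= [X in (_ < X)%N](bigD1 (u, b)) //=.
rewrite -addSn leq_add //.
  by rewrite /shift /= mb /= tpermL -addSn leq_add2r.
apply: leq_sum => -[a c] /andP[/= Eac _]; rewrite /shift /=.
case: ifP => mc /=; first by rewrite leq_add2r (lt_perm a c).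
case: ifP => //= ma; rewrite leq_add2l (lt_perm c a) //.
by rewrite Es.
Qed.

(** * Compression does not decrease the number of homomorphisms *)

(* Since [E] is reflexive, [E] restricted to [{u, v}] is complete or the
   identity; only in the latter case does an edge inside the preimage of
   [{u, v}] constrain [phi], which is then constant along it. *)
Definition inner_edge (S T : finType) (e : rel S) (E : rel T) (u v : T)
    (phi : {ffun S -> T}) : rel S :=
  fun x y => [&& ~~ E u v, e x y, phi x \in pred2 u v & phi y \in pred2 u v].

(* The value at [w] is forced when some [w'] tied to [w] has a neighbour [x]
   mapped outside [{u, v}] to a vertex not adjacent to both [u] and [v].
   This depends only on the preimage of [{u, v}] and on [phi] outside it. *)
Definition forced (S T : finType) (e : rel S) (E : rel T) (u v : T)
    (phi : {ffun S -> T}) (w : S) : bool :=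
  [exists w', connect (inner_edge e E u v phi) w w' && (phi w' \in pred2 u v) &&
    [exists x, [&& e w' x, phi x \notin pred2 u v &
                   ~~ (E u (phi x) && E v (phi x))]]].

Definition compress_hom (S T : finType) (e : rel S) (E : rel T) (u v : T)
    (phi : {ffun S -> T}) : {ffun S -> T} :=
  [ffun w => if (phi w \in pred2 u v) && forced e E u v phi w then v
             else phi w].

Lemma compress_hom_pred2 (S T : finType) (e : rel S) (E : rel T) (u v : T)
    (phi : {ffun S -> T}) (w : S) :
  (compress_hom e E u v phi w \in pred2 u v) = (phi w \in pred2 u v).
Proof.
rewrite ffunE; case: ifP => // /andP[-> _].
by rewrite !inE eqxx orbT.
Qed.

Lemma compress_hom_out (S T : finType) (e : rel S) (E : rel T) (u v : T)
    (phi : {ffun S -> T}) (w : S) :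
  phi w \notin pred2 u v -> compress_hom e E u v phi w = phi w.
Proof. by move=> /negbTE h; rewrite ffunE h. Qed.

(** [compress_hom] preserves the data on which [forced] depends, so the overwritten vertices can be
    recognised from the image. *)
Lemma forced_compress_hom (S T : finType) (e : rel S) (E : rel T) (u v : T)
    (phi : {ffun S -> T}) :
  forced e E u v (compress_hom e E u v phi) =1 forced e E u v phi.
Proof.
move=> w; rewrite /forced; apply: eq_existsb => w'.
rewrite compress_hom_pred2; congr (_ && _ && _).
  apply: eq_connect => x y.
  by rewrite /inner_edge !compress_hom_pred2.
apply: eq_existsb => x; rewrite compress_hom_pred2.
case: (boolP (phi x \in pred2 u v)) => hx; rewrite ?andbF //=.
by rewrite compress_hom_out.
Qed.

Lemma forced_edge (S T : finType) (e : rel S) (E : rel T) (u v : T)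
    (phi : {ffun S -> T}) (x y : S) :
  symmetric e -> inner_edge e E u v phi x y ->
  forced e E u v phi x = forced e E u v phi y.
Proof.
move=> es rxy; apply: eq_existsb => w'; congr (_ && _ && _).
apply: same_connect (connect1 rxy) _.
apply: sym_connect_sym => a b.
by rewrite /inner_edge es; congr (_ && (_ && _)); rewrite andbC.
Qed.

Lemma hom_inner_edge (S T : finType) (e : rel S) (E : rel T) (u v : T)
    (phi : {ffun S -> T}) (x y : S) :
  symmetric E -> phi \in rel_homs e E ->
  inner_edge e E u v phi x y -> phi x = phi y.
Proof.
move=> Es /rel_homsP hom /and4P[nuv exy hx hy].
have := hom _ _ exy.
case/orP: hx => /eqP ->; case/orP: hy => /eqP -> //.
  by rewrite (negbTE nuv).
by rewrite Es (negbTE nuv).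
Qed.

Lemma hom_inner_connect (S T : finType) (e : rel S) (E : rel T) (u v : T)
    (phi : {ffun S -> T}) (x y : S) :
  symmetric E -> phi \in rel_homs e E ->
  connect (inner_edge e E u v phi) x y -> phi x = phi y.
Proof.
move=> Es hom /connectP[p]; elim: p x => [|z p IH] x /=; first by move=> _ ->.
by case/andP=> /(hom_inner_edge Es hom) -> /IH; apply.
Qed.

(** Cases on how many ends of an edge land in [{u, v}]. With one end there, a forced vertex goes to
    [v], which has acquired the outside neighbours of [u]; an unforced one sees an image adjacent to
    both. With two, either [E u v] allows every choice, or the ends are tied and move together. *)
Lemma compress_hom_hom (S T : finType) (e : rel S) (E : rel T) (u v : T)
    (phi : {ffun S -> T}) :
  symmetric e -> symmetric E -> reflexive E ->
  phi \in rel_homs e E ->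
  compress_hom e E u v phi \in rel_homs e (compress E u v).
Proof.
move=> es Es Er hom; have /rel_homsP homP := hom.
have mixed x y : e x y -> phi x \in pred2 u v -> phi y \notin pred2 u v ->
    compress E u v (compress_hom e E u v phi x) (compress_hom e E u v phi y).
  move=> exy hx hy; rewrite (compress_hom_out _ _ hy) ffunE hx /=.
  have := homP _ _ exy.
  have /norP[/= yu yv] := hy.
  case: ifP => fx.
    by rewrite compress_r //; case/orP: hx => /eqP -> -> //; rewrite orbT.
  move=> _; have /andP[Euy Evy] : E u (phi y) && E v (phi y).
    apply: contraFT fx => h; apply/existsP; exists x.
    by rewrite connect0 hx /=; apply/existsP; exists y; rewrite exy hy.
  by case/orP: hx => /eqP ->; rewrite ?compress_l ?compress_r ?Euy ?Evy.
apply/rel_homsP => x y exy.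
case: (boolP (phi x \in pred2 u v)) => hx; last first.
  case: (boolP (phi y \in pred2 u v)) => hy.
    by rewrite (compress_sym _ _ Es) mixed // es.
  rewrite !compress_hom_out // compress_out ?homP //.
  - by case/norP: hx.
  - by case/norP: hx.
  - by case/norP: hy.
  - by case/norP: hy.
case: (boolP (phi y \in pred2 u v)) => hy; last exact: mixed.
rewrite compress_in ?compress_hom_pred2 //.
case: (boolP (E u v)) => Euv.
  have full a b : a \in pred2 u v -> b \in pred2 u v -> E a b.
    by case/orP => /eqP ->; case/orP => /eqP -> //; rewrite Es.
  by apply: full; rewrite compress_hom_pred2.
have rxy : inner_edge e E u v phi x y by rewrite /inner_edge Euv exy hx hy.
by rewrite !ffunE hx hy (forced_edge es rxy) (hom_inner_edge Es hom rxy) Er.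
Qed.

(** Only forced values are overwritten. Such a vertex is tied to a neighbour of some [x] whose
    image, the same for both maps, is adjacent to exactly one of [u] and [v]; this determines the
    value. *)
Lemma compress_hom_inj (S T : finType) (e : rel S) (E : rel T) (u v : T) :
  symmetric E ->
  {in rel_homs e E &, injective (compress_hom e E u v)}.
Proof.
move=> Es phi1 phi2 hom1 hom2 eq12.
have /rel_homsP hom1P := hom1; have /rel_homsP hom2P := hom2.
have eqW w : (phi1 w \in pred2 u v) = (phi2 w \in pred2 u v).
  by rewrite -(compress_hom_pred2 e E) eq12 compress_hom_pred2.
have eqout w : phi1 w \notin pred2 u v -> phi1 w = phi2 w.
  move=> h; rewrite -(compress_hom_out e E h) eq12 compress_hom_out //.
  by rewrite -eqW.
apply/ffunP => w.
case: (boolP (phi1 w \in pred2 u v)) => hw; last exact: eqout.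
have f12 : forced e E u v phi1 w = forced e E u v phi2 w.
  by rewrite -forced_compress_hom eq12 forced_compress_hom.
case: (boolP (forced e E u v phi1 w)) => fw; last first.
  move/ffunP/(_ w): eq12.
  by rewrite !ffunE -f12 (negbTE fw) !andbF.
case/existsP: fw => w' /andP[/andP[con hw'] /existsP[x /and3P[ex hx nx]]].
rewrite (hom_inner_connect Es hom1 con).
have con2 : connect (inner_edge e E u v phi2) w w'.
  rewrite (eq_connect (e' := inner_edge e E u v phi1)) // => a b.
  by rewrite /inner_edge !eqW.
rewrite (hom_inner_connect Es hom2 con2).
have := hom1P _ _ ex; have := hom2P _ _ ex; rewrite -(eqout _ hx).
have hw2 := hw'; rewrite eqW in hw2.
move: nx; case/orP: hw' => /eqP ->; case/orP: hw2 => /eqP -> // nx h2 h1.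
  by rewrite h1 h2 in nx.
by rewrite h1 h2 in nx.
Qed.

Lemma rel_homs_compress (S T : finType) (e : rel S) (E : rel T) (u v : T) :
  symmetric e -> symmetric E -> reflexive E ->
  (#|rel_homs e E| <= #|rel_homs e (compress E u v)|)%N.
Proof.
move=> es Es Er; rewrite -(card_in_imset (compress_hom_inj (u := u) (v := v) Es)).
apply/subset_leq_card/fintype.subsetP => _ /imsetP[phi hom ->].
exact: compress_hom_hom.
Qed.

(** Induction on [rank_sum]. The last clause nests the neighbourhoods along the enumeration order,
    up to [u] and [v] themselves. *)
Lemma exists_nested_rel (S T : finType) (e : rel S) (E : rel T) :
  symmetric e -> symmetric E -> reflexive E ->
  exists F : rel T,
    [/\ symmetric F, reflexive F,
        #|[set p | F p.1 p.2]%SET| = #|[set p | E p.1 p.2]%SET|,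
        (#|rel_homs e E| <= #|rel_homs e F|)%N
      & forall u v b, (enum_rank v < enum_rank u)%N -> ~~ moved F u v b].
Proof.
move=> es; have [n] := ubnP (rank_sum E); elim: n E => // n IH E ltEn Es Er.
have [/existsP[u /existsP[v /existsP[b /andP[ltvu mb]]]]|] :=
    boolP [exists u, exists v, exists b,
             (enum_rank v < enum_rank u)%N && moved E u v b].
  have [|||F [Fs Fr cF hF nF]] := IH (compress E u v).
  - exact: leq_trans (rank_sum_compress Es ltvu mb) ltEn.
  - exact: compress_sym.
  - exact: compress_refl.
  exists F; split => //; first by rewrite cF card_compress.
  exact: leq_trans (rel_homs_compress _ _ es Es Er) hF.
move=> nE; exists E; split=> // u v b ltvu; apply: contra nE => mb.
apply/existsP; exists u; apply/existsP; exists v; apply/existsP; exists b.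
by rewrite ltvu.
Qed.

(** * Removal of the loops *)

Definition loopless (T : finType) (E : rel T) : rel T :=
  fun a b => (a != b) && E a b.

Lemma loopless_sym (T : finType) (E : rel T) :
  symmetric E -> symmetric (loopless E).
Proof. by move=> Es a b; rewrite /loopless eq_sym Es. Qed.

Lemma loopless_irr (T : finType) (E : rel T) : irreflexive (loopless E).
Proof. by move=> a; rewrite /loopless eqxx. Qed.

Lemma card_loopless (T : finType) (E : rel T) : reflexive E ->
  (#|[set p | loopless E p.1 p.2]%SET| + #|T| =
     #|[set p | E p.1 p.2]%SET|)%N.
Proof.
move=> Er.
rewrite -(cardsID [set p : T * T | p.1 == p.2]%SET [set p | E p.1 p.2]%SET).
rewrite addnC; congr (_ + _)%N; last first.
  by apply: eq_card => p; rewrite !inE.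
rewrite -(card_imset (f := fun a : T => (a, a))); last by move=> a b [].
apply: eq_card => -[a b]; rewrite !inE /=.
apply/imsetP/andP => [[c _ [-> ->]]|[_ /eqP ->]]; first by rewrite Er eqxx.
by exists b.
Qed.

(** Overwriting [phi x] by an arbitrary value is injective on pairs, since the lost value survives
    at [y]. *)
Lemma card_coincide (S T : finType) (x y : S) : x != y ->
  (#|T| * #|[set phi : {ffun S -> T} | phi x == phi y]%SET| <= #|T| ^ #|S|)%N.
Proof.
move=> xy; rewrite -card_ffun -cardsT -cardsX.
pose f (p : T * {ffun S -> T}) : {ffun S -> T} :=
  [ffun z => if z == x then p.1 else p.2 z].
rewrite -(card_in_imset (f := f)) ?max_card //.
move=> [a phi] [b psi]; rewrite !inE /= => /eqP h1 /eqP h2 /ffunP eqf.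
have eab : a = b by have := eqf x; rewrite !ffunE eqxx.
have eqz z : z != x -> phi z = psi z.
  by move=> /negbTE zx; have := eqf z; rewrite !ffunE zx.
congr (_, _) => //; apply/ffunP => z.
by case: (eqVneq z x) => [->|/eqz //]; rewrite h1 h2 eqz // eq_sym.
Qed.

(** A lost homomorphism identifies the ends of an edge, which are distinct; a union bound over at
    most [#|S| ^ 2] pairs applies [card_coincide]. *)
Lemma rel_homs_loopless (S T : finType) (e : rel S) (E : rel T) :
  irreflexive e ->
  (#|T| * #|rel_homs e E| <=
     #|T| * #|rel_homs e (loopless E)| + #|S| ^ 2 * #|T| ^ #|S|)%N.
Proof.
move=> ei.
pose bad (q : S * S) := [set phi : {ffun S -> T} | phi q.1 == phi q.2]%SET.
have sub : rel_homs e E \subset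
    (rel_homs e (loopless E) :|: \bigcup_(q : S * S | q.1 != q.2) bad q)%SET.
  apply/fintype.subsetP => phi /rel_homsP hom; rewrite inE.
  case: (boolP (phi \in rel_homs e (loopless E))) => //= nh.
  have /existsP[x /existsP[y /andP[exy exy']]] :
      [exists x, exists y, e x y && (phi x == phi y)].
    apply: contraR nh => nh; apply/rel_homsP => x y exy.
    rewrite /loopless hom // andbT; apply: contra nh => h.
    by apply/existsP; exists x; apply/existsP; exists y; rewrite exy.
  apply/bigcupP; exists (x, y); rewrite ?inE //=.
  by apply: contraTneq exy => ->; rewrite ei.
have card_le := leq_trans (subset_leq_card sub) (leq_card_setU _ _).1.
apply: leq_trans (leq_mul (leqnn #|T|) card_le) _.
rewrite mulnDr leq_add2l.
have le_bad : (#|\bigcup_(q : S * S | q.1 != q.2) bad q|%SET <=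
               \sum_(q : S * S | q.1 != q.2) #|bad q|)%N.
  elim/big_rec2: _ => [|q m B _ IH]; first by rewrite cards0.
  by apply: leq_trans (leq_card_setU _ _).1 _; rewrite leq_add2l.
apply: leq_trans (leq_mul (leqnn _) le_bad) _.
rewrite big_distrr /=.
apply: leq_trans (leq_sum _ (fun q => @card_coincide S T q.1 q.2)) _.
rewrite sum_nat_const leq_mul2r; apply/orP; right.
by rewrite (leq_trans (max_card _)) // card_prod mulnn.
Qed.

(** * Threshold graphs with the same edge count *)

Lemma num_homE (H G : graph) :
  num_hom H G = #|rel_homs (@edge H) (@edge G)|.
Proof. by []. Qed.

Lemma num_hom_K2 (G : graph) :
  num_hom K2 G = #|[set p : G * G | edge p.1 p.2]%SET|.
Proof.
pose f (p : G * G) : {ffun K2 -> G} :=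
  [ffun i : 'I_2 => if i == ord0 then p.1 else p.2].
have f_inj : injective f.
  move=> [a b] [c d] /ffunP eqf.
  have := eqf (ord0 : 'I_2); have := eqf (ord_max : 'I_2).
  by rewrite !ffunE /= => -> ->.
rewrite -(card_imset _ f_inj) num_homE; apply: eq_card => phi.
apply/rel_homsP/imsetP => [hom|[p pE ->] x y].
  exists (phi (ord0 : 'I_2), phi (ord_max : 'I_2)).
    by rewrite inE; apply: hom.
  apply/ffunP => i; rewrite ffunE; case: eqP => [->//|/eqP i0] /=.
  congr (phi _); apply/val_inj; move: i0; rewrite -val_eqE /=.
  by case: i => -[|[|]].
rewrite inE in pE; rewrite !ffunE.
change (K2_edge x y -> edge (if x == ord0 :> 'I_2 then p.1 else p.2)
  (if y == ord0 :> 'I_2 then p.1 else p.2)).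
rewrite /K2_edge; case: (eqVneq (x : 'I_2) ord0) => [->|x0].
  by rewrite eq_sym => /negbTE ->.
case: (eqVneq (y : 'I_2) ord0) => [_ _|y0]; first by rewrite edge_sym.
have two (i : 'I_2) : i != ord0 -> i = ord_max.
  by move=> i0; apply/val_inj; move: i0; rewrite -val_eqE /=; case: i => -[|[|]].
by rewrite (two _ x0) (two _ y0) eqxx.
Qed.

Lemma exists_threshold (H G : graph) :
  exists G' : graph,
    [/\ is_threshold G', #|G'| = #|G|, num_hom K2 G' = num_hom K2 G
      & (#|G| * num_hom H G <=
           #|G| * num_hom H G' + #|H| ^ 2 * #|G| ^ #|H|)%N].
Proof.
pose E : rel G := fun a b => (a == b) || edge a b.
have Es : symmetric E by move=> a b; rewrite /E eq_sym edge_sym.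
have Er : reflexive E by move=> a; rewrite /E eqxx.
have [F [Fs Fr cF hF nF]] := exists_nested_rel (@edge_sym H) Es Er.
exists (Graph (loopless_sym Fs) (loopless_irr F)); split => //.
- suff nested u v : (enum_rank v < enum_rank u)%N ->
      [set w | loopless F u w]%SET \subset (v |: [set w | loopless F v w])%SET.
    move=> u v; case: (ltngtP (enum_rank u) (enum_rank v)) => [lt|lt|/val_inj].
    + by right; apply: nested.
    + by left; apply: nested.
    + by move/enum_rank_inj => ->; left; exact: finset.subsetUr.
  (* A neighbour [b] of [u] is [v] itself, which the closed neighbourhood admits, or is not moved
     and hence adjacent to [v]. *)
  move=> ltvu; apply/fintype.subsetP => b; rewrite !inE /loopless.
  case/andP => ub Fub; case: (eqVneq b v) => //= bv.
  have := nF u v b ltvu.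
  by rewrite /moved eq_sym ub bv Fub /= negbK.
- rewrite !num_hom_K2; apply/eqP; rewrite -(eqn_add2r #|G|).
  rewrite (card_loopless Fr) cF -(card_loopless Er) eqn_add2r.
  apply/eqP/eq_card => -[a b]; rewrite !inE /loopless /E /=.
  by case: eqP => [->|//]; rewrite edge_irr.
rewrite !num_homE; apply: leq_trans (rel_homs_loopless F (@edge_irr H)).
rewrite leq_mul2l; apply/orP; right; apply: leq_trans hF.
apply/subset_leq_card/fintype.subsetP => phi /rel_homsP hom.
by apply/rel_homsP => x y /hom exy; rewrite /E exy orbT.
Qed.

(** * Densities and the upper limit *)

Local Open Scope ring_scope.

Lemma hom_density_threshold (R : realType) (H G : graph) : (0 < #|G|)%N ->
  exists G' : graph,
    [/\ is_threshold G', #|G'| = #|G|,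
        hom_density R K2 G' = hom_density R K2 G
      & hom_density R H G <= hom_density R H G' + (#|H| ^ 2)%:R / #|G|%:R].
Proof.
move=> G0; have [G' [thr cG' eK leH]] := exists_threshold H G.
exists G'; split => //; first by rewrite /hom_density eK cG'.
have n0 : 0 < #|G|%:R :> R by rewrite ltr0n.
rewrite /hom_density cG' ler_pdivrMr ?exprn_gt0 // mulrDl divfK; last first.
  by rewrite expf_neq0 // gt_eqF.
rewrite -(ler_pM2l n0) mulrDr mulrA mulrCA divff ?gt_eqF // mulr1.
by rewrite -natrX -!natrM -natrD ler_nat.
Qed.

Theorem theorem1p3 (R : realType) (H : graph) (c : R) (hc : 0 <= c <= 1) :
  max_density H c = graph_limsup (density_class c) (hom_density R H) /\
  graph_limsup (density_class c) (hom_density R H) =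
    graph_limsup (fun G => density_class c G /\ is_threshold G)
      (hom_density R H).
Proof.
(* The first equality is definitional; one inequality of the second is monotonicity in the class. *)
split=> //; apply/eqP; rewrite eq_le; apply/andP; split; last first.
  apply: lee_lim; [exact: is_cvg_sup_from|exact: is_cvg_sup_from|].
  apply: nearW => n; apply: ereal_sup_le => _ [G [[CG _] nG ->]].
  by exists G.
pose b := sup_from (fun G => density_class c G /\ is_threshold G)
  (hom_density R H).
(* An error bound uniform over the graphs with at least [n] vertices, for positive [n]. *)
pose eps n : \bar R := ((#|H| ^ 2)%:R / n%:R)%:E.
have eps0 : (eps n @[n --> \oo] --> 0%:E)%classic.
  apply: cvg_EFin; first exact: nearW.
  rewrite -(mulr0 (#|H| ^ 2)%:R); apply: cvgMr.
  (* The harmonic sequence is [1 / (n + 1)], hence the shift. *)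
  rewrite -cvg_shiftS; exact: cvg_harmonic.
(* The limit of [eps] is finite, so the sum of limits is defined even if [limn b] is infinite. *)
have cvgb : ((b n + eps n)%E @[n --> \oo] --> (limn b + 0%:E)%E)%classic.
  apply: cvgeD => //; first by rewrite fin_num_adde_defl.
  exact: is_cvg_sup_from.
rewrite /graph_limsup -/b -[limn b]adde0 -(cvg_lim _ cvgb) //.
apply: lee_lim; [exact: is_cvg_sup_from|by apply/cvg_ex; exists (limn b + 0)%E|].
near=> n; apply: ge_ereal_sup => _ [G [CG nG ->]].
have n0 : (0 < n)%N by near: n; exact: nbhs_infty_gt.
have [G' [thr cG' eK leH]] := hom_density_threshold R H (leq_trans n0 nG).
apply: (@le_trans _ _ ((hom_density R H G')%:E + eps n)%E).
  rewrite -EFinD lee_fin (le_trans leH) // lerD2l ler_wpM2l //.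
  by rewrite lef_pV2 ?posrE ?ltr0n ?ler_nat // (leq_trans n0).
rewrite leeD2r //; apply: ereal_sup_ubound; exists G'; rewrite cG'.
(* Equal edge density keeps [G'] in the class. *)
by split=> //; split=> //; rewrite /density_class eK.
Unshelve. all: by end_near.
Qed.
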